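(* Let $n\ge 1$ be an integer and $0<s<1$. There is a constant $C_{n,s}>0$ depending only on $n$ and $s$ such that for every $u\in\mathscr S(\mathbb R^n)$ and every $x\in\mathbb R^n$ with $|x|>1$, $$|(-\Delta)^s u(x)|\le C_{u,n,s}\,|x|^{-(n+2s)},\qquad C_{u,n,s}=C_{n,s}\left(\|u\|_{n+2}+\|u\|_n+\|u\|_{L^1(\mathbb R^n)}\right).$$
   Context: $\mathscr S(\mathbb R^n)$ is the Schwartz space of rapidly decreasing functions. For an integer $p\ge 0$, $\|f\|_p=\sup_{|\alpha|\le p}\ \sup_{x\in\mathbb R^n}(1+|x|^2)^{p/2}|\partial^\alpha f(x)|$. The fractional Laplacean of $u\in\mathscr S(\mathbb R^n)$ is defined pointwise by the (absolutely convergent) integral $$(-\Delta)^s u(x)=\frac{\gamma(n,s)}{2}\int_{\mathbb R^n}\frac{2u(x)-u(x+y)-u(x-y)}{|y|^{n+2s}}\,dy,$$ where $\gamma(n,s)>0$ is the constant $\gamma(n,s)=\dfrac{s\,2^{2s}\,\Gamma\left(\frac{n+2s}{2}\right)}{\pi^{n/2}\,\Gamma(1-s)}$. *)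

(* Defs.v *)
From HB Require Import structures.
From mathcomp Require Import all_boot all_order all_algebra.
From mathcomp Require Import all_classical all_reals all_analysis.
From mathcomp Require Import complex.

Set Implicit Arguments.
Unset Strict Implicit.
Unset Printing Implicit Defensive.
Import Order.TTheory GRing.Theory Num.Theory.
Import numFieldNormedType.Exports.

Local Open Scope classical_set_scope.
Local Open Scope ring_scope.
Local Open Scope complex_scope.

(* The library normed structure on 'rV[R]_n carries the max norm; the
   Euclidean length is needed here. *)
Definition enorm (R : realType) (n : nat) (x : 'rV[R]_n) : R :=
  Num.sqrt (\sum_(i < n) x ord0 i ^+ 2).

(* The Borel sigma-algebra of R^n, presented as the product sigma-algebra
   (as the library does for n.-tuple T). *)
Definition measure_rV_display : measure_display.
Proof. exact: default_measure_display. Qed.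

Section measurable_rV.
Variables (R : realType) (n : nat).

Let coord (i : 'I_n) (x : 'rV[R]_n) : measurableTypeR R := x ord0 i.

Let rV_set0 : g_sigma_preimage coord set0.
Proof. exact: sigma_algebra0. Qed.

Let rV_setC A : g_sigma_preimage coord A -> g_sigma_preimage coord (~` A).
Proof. exact: sigma_algebraC. Qed.

Let rV_bigcup (F : _^nat) : (forall i, g_sigma_preimage coord (F i)) ->
  g_sigma_preimage coord (\bigcup_i (F i)).
Proof. exact: sigma_algebra_bigcup. Qed.

HB.instance Definition _ := @isMeasurable.Build measure_rV_display
  'rV[R]_n (g_sigma_preimage coord) rV_set0 rV_setC rV_bigcup.

Lemma measurable_rV_coord (i : 'I_n) :
  measurable_fun [set: 'rV[R]_n] (fun x => x ord0 i : measurableTypeR R).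
Proof.
move=> _ Y mY; rewrite setTI; apply: sub_sigma_algebra => /=.
rewrite -bigcup_seq/=; exists i => /=; first by rewrite mem_index_enum.
by exists Y => //; rewrite setTI.
Qed.

Lemma measurable_fun_rVP d (T : measurableType d) (f : T -> 'rV[R]_n) :
  measurable_fun [set: T] f <->
  forall i, measurable_fun [set: T] (fun t => f t ord0 i : measurableTypeR R).
Proof.
split=> [mf i|mf].
  exact: (measurableT_comp (measurable_rV_coord i) mf).
move=> _ A mA; rewrite setTI.
pose G : set (set 'rV[R]_n) := [set B | measurable (f @^-1` B)].
suff sG : g_sigma_preimage coord `<=` G by exact: (sG A mA).
apply: smallest_sub.
  split=> [|B mB|F mF]; rewrite /G/=; first by rewrite preimage_set0.
    by rewrite setTD preimage_setC; exact: measurableC.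
  by rewrite preimage_bigcup; apply: bigcup_measurable => k _; exact: mF.
rewrite -bigcup_seq/= => B [i _ [C mC <-]]; rewrite /G/= setTI.
by have := mf i measurableT C mC; rewrite setTI.
Qed.

End measurable_rV.

Section lebesgue_rV.
Variable R : realType.
Local Open Scope ereal_scope.

Definition rV_cons (n : nat) (p : measurableTypeR R * 'rV[R]_n) : 'rV[R]_n.+1 :=
  \row_i oapp (p.2 ord0) p.1 (unlift ord0 i).

(* Lebesgue measure on R^n: the n-fold product of the Lebesgue measure of R. *)
Fixpoint lebesgue_rV (n : nat) : set 'rV[R]_n -> \bar R :=
  if n is m.+1 then
    pushforward (@lebesgue_measure R \x @lebesgue_rV m) (@rV_cons m)
  else \d_(0%R : 'rV[R]_0).

Lemma measurable_rV_cons n : measurable_fun setT (@rV_cons n).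
Proof.
apply/measurable_fun_rVP => i; case: (unliftP ord0 i) => [j|] ->.
  rewrite (_ : (fun _ => _) =
      (fun x : 'rV[R]_n => x ord0 j : measurableTypeR R) \o snd).
    by apply: measurableT_comp => //; exact: measurable_rV_coord.
  by apply/funext => p; rewrite /= mxE liftK.
rewrite (_ : (fun _ => _) = fst)//.
by apply/funext => p; rewrite mxE unlift_none.
Qed.

Definition rV_uncons (n : nat) (x : 'rV[R]_n.+1) :
    measurableTypeR R * 'rV[R]_n :=
  (x ord0 ord0, \row_j x ord0 (lift ord0 j)).

Lemma rV_unconsK n : cancel (@rV_uncons n) (@rV_cons n).
Proof.
move=> x; apply/rowP => i; rewrite mxE.
by case: (unliftP ord0 i) => [j|] -> //=; rewrite mxE.
Qed.

Lemma rV_consK n : cancel (@rV_cons n) (@rV_uncons n).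
Proof.
move=> [a x]; congr pair; first by rewrite mxE unlift_none.
by apply/rowP => j; rewrite !mxE liftK.
Qed.

Lemma measurable_rV_uncons n : measurable_fun setT (@rV_uncons n).
Proof.
apply/measurable_fun_pairP; split; first exact: measurable_rV_coord.
apply/measurable_fun_rVP => i.
rewrite (_ : (fun _ => _) =
    (fun x : 'rV[R]_n.+1 => x ord0 (lift ord0 i) : measurableTypeR R)).
  exact: measurable_rV_coord.
by apply/funext => x; rewrite /= mxE.
Qed.

Section step.
Variables (n : nat) (mu : {sigma_finite_measure set 'rV[R]_n -> \bar R}).

Let step := pushforward (@lebesgue_measure R \x mu) (@rV_cons n).

Let mstep (A : set 'rV[R]_n.+1) :
  measurable A -> measurable (@rV_cons n @^-1` A).
Proof.
by move=> mA; rewrite -[X in measurable X]setTI; exact: measurable_rV_cons.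
Qed.

Let step0 : step set0 = 0.
Proof. by rewrite /step /pushforward preimage_set0 measure0. Qed.

Let step_ge0 A : 0 <= step A.
Proof. by rewrite /step /pushforward measure_ge0. Qed.

Let step_sigma_additive : semi_sigma_additive step.
Proof.
move=> F mF tF mUF; rewrite /step /pushforward preimage_bigcup.
apply: measure_semi_sigma_additive.
- by move=> k; exact: mstep.
- apply/trivIsetP => /= i j _ _ ij; rewrite -preimage_setI.
  by move/trivIsetP : tF => /(_ _ _ _ _ ij) ->//; rewrite preimage_set0.
- by rewrite -preimage_bigcup; exact: mstep.
Qed.

HB.instance Definition _ := isMeasure.Build _ _ _ step
  step0 step_ge0 step_sigma_additive.

Let step_sigma_finite : sigma_finite setT step.
Proof.
have /sigma_finiteP[F [FT ndF Foo]] := sigma_finiteT (@lebesgue_measure R).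
have /sigma_finiteP[G [GT ndG Goo]] := sigma_finiteT mu.
exists (fun k => @rV_uncons n @^-1` (F k `*` G k)).
  rewrite -preimage_bigcup (_ : \bigcup_i _ = setT) ?preimage_setT//.
  rewrite -subTset => -[x y] _.
  have [i _ Fx] : (\bigcup_i F i) x by rewrite -FT.
  have [j _ Gy] : (\bigcup_i G i) y by rewrite -GT.
  exists (maxn i j) => //; split => /=.
    by move: x Fx; exact/subsetPset/ndF/leq_maxl.
  by move: y Gy; exact/subsetPset/ndG/leq_maxr.
move=> k; have [mF Fk] := Foo k; have [mG Gk] := Goo k; split.
  rewrite -[X in measurable X]setTI; apply: measurable_rV_uncons => //.
  exact: measurableX.
rewrite /step /pushforward -comp_preimage (_ : _ \o _ = id); last first.
  by apply/funext => p; exact: rV_consK.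
by rewrite preimage_id product_measure1E// lte_mul_pinfty// ge0_fin_numE.
Qed.

HB.instance Definition _ := Measure_isSigmaFinite.Build _ _ _ step
  step_sigma_finite.

Definition lebesgue_rV_step : {sigma_finite_measure set 'rV[R]_n.+1 -> \bar R} :=
  step.

End step.

Let lebesgue_rV_ex n :
  {mu : {sigma_finite_measure set 'rV[R]_n -> \bar R} |
    @lebesgue_rV n = mu :> (set 'rV[R]_n -> \bar R)}.
Proof.
elim: n => [|n [mu muE]].
  by exists [the {sigma_finite_measure set 'rV[R]_0 -> \bar R} of \d_(0%R : 'rV[R]_0)].
by exists (lebesgue_rV_step mu); rewrite /= muE.
Qed.

Let lebesgue_rV0 n : @lebesgue_rV n set0 = 0.
Proof. by have [mu ->] := lebesgue_rV_ex n. Qed.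

Let lebesgue_rV_ge0 n A : 0 <= @lebesgue_rV n A.
Proof. by have [mu ->] := lebesgue_rV_ex n. Qed.

Let lebesgue_rV_sigma_additive n : semi_sigma_additive (@lebesgue_rV n).
Proof.
by have [mu ->] := lebesgue_rV_ex n; exact: measure_semi_sigma_additive.
Qed.

HB.instance Definition _ n := isMeasure.Build _ _ _ (@lebesgue_rV n)
  (@lebesgue_rV0 n) (@lebesgue_rV_ge0 n) (@lebesgue_rV_sigma_additive n).

Let lebesgue_rV_sigma_finite n : sigma_finite setT (@lebesgue_rV n).
Proof. by have [mu ->] := lebesgue_rV_ex n; exact: sigma_finiteT. Qed.

HB.instance Definition _ n := Measure_isSigmaFinite.Build _ _ _ (@lebesgue_rV n)
  (@lebesgue_rV_sigma_finite n).

Lemma lebesgue_rV_box (n : nat) (A : 'I_n -> set (measurableTypeR R)) :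
  (forall i, measurable (A i)) ->
  @lebesgue_rV n [set x : 'rV[R]_n | forall i, A i (x ord0 i)] =
  \prod_(i < n) lebesgue_measure (A i).
Proof.
elim: n A => [|n IH] A mA.
  by rewrite big_ord0 /= diracE mem_set// => -[].
rewrite big_ord_recl -IH// /= /pushforward.
transitivity ((@lebesgue_measure R \x @lebesgue_rV n)
  (A ord0 `*` [set x : 'rV[R]_n | forall i, A (lift ord0 i) (x ord0 i)])).
  congr product_measure1; apply/seteqP; split=> [p Ap|p [A0 A1] i]; first split => [|i].
  - by have := Ap ord0; rewrite mxE unlift_none.
  - by have := Ap (lift ord0 i); rewrite mxE liftK.
  - rewrite mxE; case: unliftP => [j|] -> //=; exact: A1.
rewrite product_measure1E//.
rewrite (_ : mkset _ = \bigcap_(i in [set: 'I_n])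
    ((fun x : 'rV[R]_n => x ord0 i : measurableTypeR R) @^-1`
      A (lift ord0 i))).
  apply: fin_bigcap_measurable => //= i _.
  rewrite -[X in measurable X]setTI; exact: measurable_rV_coord.
by apply/seteqP; split => [x h i _|x h i]; apply: h.
Qed.
End lebesgue_rV.

Definition Gamma (R : realType) (a : R) : R :=
  \int[@lebesgue_measure R]_(t in `]0, +oo[) (t `^ (a - 1) * expR (- t)).

(* The library only has integrals of functions valued in R or \bar R. *)
Definition cintegral d (T : measurableType d) (R : realType)
    (mu : {measure set T -> \bar R}) (f : T -> R[i]) : R[i] :=
  (\int[mu]_x complex.Re (f x)) +i* (\int[mu]_x complex.Im (f x)).

Section schwartz.
Variables (R : realType) (n : nat).
Implicit Types (f : 'rV[R]_n -> R) (u : 'rV[R]_n -> R[i]) (x : 'rV[R]_n).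

Definition partial (i : 'I_n) f : 'rV[R]_n -> R := 'D_(delta_mx ord0 i) f.

Definition partials (s : seq 'I_n) f : 'rV[R]_n -> R := foldr partial f s.

(* C^oo: the iterated partial derivatives of all orders exist and are
   continuous. *)
Definition smooth f : Prop :=
  forall s : seq 'I_n,
    (forall i x, derivable (partials s f) x (delta_mx ord0 i)) /\
    continuous (partials s f).

Definition mderiv (alpha : 'I_n -> nat) f : 'rV[R]_n -> R :=
  foldr (fun i => iter (alpha i) (partial i)) f (enum 'I_n).

(* A complex-valued function is differentiated through its real and imaginary
   parts: R[i] has no normed module structure over R in the library. *)
Definition csmooth u : Prop :=
  smooth (fun x => complex.Re (u x)) /\ smooth (fun x => complex.Im (u x)).

Definition cmderiv (alpha : 'I_n -> nat) u x : R[i] :=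
  mderiv alpha (fun y => complex.Re (u y)) x +i*
  mderiv alpha (fun y => complex.Im (u y)) x.

Definition schwartz_norm (p : nat) u : \bar R :=
  ereal_sup [set ereal_sup (range (fun x : 'rV[R]_n =>
      ((1 + enorm x ^+ 2) `^ (p%:R / 2) * Normc.normc (cmderiv alpha u x))%:E))
    | alpha in [set alpha : 'I_n -> nat | (\sum_i alpha i <= p)%N]].

Definition schwartz u : Prop :=
  csmooth u /\ forall p, (schwartz_norm p u < +oo)%E.

Definition fracLap_cst (s : R) : R :=
  s * 2 `^ (2 * s) * Gamma ((n%:R + 2 * s) / 2) /
  (pi `^ (n%:R / 2) * Gamma (1 - s)).

Definition fracLap (s : R) u x : R[i] :=
  (fracLap_cst s / 2)%:C *
  cintegral (@lebesgue_rV R n) (fun y : 'rV[R]_n =>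
    (2 * u x - u (x + y) - u (x - y)) / (enorm y `^ (n%:R + 2 * s))%:C).

End schwartz.

(* Main.v *)
(* Put N = ||u||_(n+2), a = n + 2 s and r = |x| / 2, and work with the real and
   imaginary parts f of u. If |y| <= r, the second difference of f at x is at
   most 2 n^2 |y|^2 sup |d_i d_j f| over points of norm >= r, hence
   O(N r^-(n+2) |y|^2). If |y| > r, then |y|^-a < r^-a, |f x| = O(N r^-n), and
   |f (x + y)|, |f (x - y)| are bounded by the integrable decay of f. Each piece
   is dominated by a series of constants times indicators of cubes of dyadic
   size, whose integral is a geometric series; all pieces come out
   O(N |x|^-a). *)
Require Import Defs.
From mathcomp Require Import all_boot all_order all_algebra.
From mathcomp Require Import all_classical all_reals all_analysis.
From mathcomp Require Import measurable_realfun complex ring lra.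
Import Order.TTheory GRing.Theory Num.Theory.
Import numFieldNormedType.Exports.
Local Open Scope classical_set_scope.
Local Open Scope ring_scope.

(** * Majorants built from indicators of cubes, and their integrals *)

Section cover.
Context {R : realType} {n : nat}.
Implicit Types (z y : 'rV[R]_n).
Local Notation mu := (@lebesgue_rV R n).

(** Cubes stand in for Euclidean balls because the product structure gives their measure at once;
    the ball of radius [a] around [z] lies inside. *)
Definition cube z (a : R) : set 'rV[R]_n :=
  [set y | forall i, `[z ord0 i - a, z ord0 i + a]%classic (y ord0 i)].

Lemma measurable_cube z a : measurable (cube z a).
Proof.
rewrite (_ : cube z a = \bigcap_(i in [set: 'I_n])
    ((fun y : 'rV[R]_n => y ord0 i : measurableTypeR R) @^-1`
      `[z ord0 i - a, z ord0 i + a]%classic)).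
  apply: fin_bigcap_measurable => //= i _.
  rewrite -[X in measurable X]setTI.
  by apply: measurable_rV_coord => //; exact: measurable_itv.
by apply/seteqP; split => [y h i _|y h i]; apply: h.
Qed.

Lemma lebesgue_rV_cube z a : 0 <= a -> mu (cube z a) = ((2 * a) ^+ n)%:E.
Proof.
move=> a0; rewrite /cube.
rewrite (@lebesgue_rV_box R n
  (fun i => `[z ord0 i - a, z ord0 i + a]%classic)); last first.
  by move=> i; exact: measurable_itv.
under eq_bigr => i _.
  rewrite lebesgue_measure_itv/= lte_fin.
  over.
have <- : (\prod_(i < n) (2 * a)%:E)%E = ((2 * a) ^+ n)%:E.
  by rewrite prodEFin prodr_const card_ord.
(* The length of an interval is given by cases on strict order of its ends; the degenerate case
   forces [a = 0], where both factors vanish. *)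
apply: eq_bigr => i _; case: ifPn => [_|].
  by rewrite -EFinD; congr EFin; ring.
rewrite -leNgt => h; have -> : a = 0 by lra.
by rewrite mulr0.
Qed.

Lemma enorm_ge0 y : 0 <= enorm y. Proof. exact: sqrtr_ge0. Qed.

Lemma ler_coord_enorm y i : `|y ord0 i| <= enorm y.
Proof.
rewrite -sqrtr_sqr ler_sqrt; last by apply: sumr_ge0 => j _; exact: sqr_ge0.
by rewrite (bigD1 i)//= lerDl sumr_ge0// => j _; exact: sqr_ge0.
Qed.

Lemma cube_enorm z y a : enorm (y - z) <= a -> cube z a y.
Proof.
move=> h i; have := ler_coord_enorm (y - z) i; rewrite !mxE /= in_itv/= => h1.
by have := le_trans h1 h; rewrite ler_norml => /andP[? ?]; apply/andP; split; lra.
Qed.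

(** A function bounded at each [y] by [c k] for some [k] whose cube contains [y] lies below this
    sum. Summing over all [k] keeps the majorant measurable, however [k] depends on [y]. *)
Definition cover z (c rho : nat -> R) y : \bar R :=
  (\sum_(0 <= k <oo) (c k * \1_(cube z (rho k)) y)%:E)%E.

Section props.
Variables (z : 'rV[R]_n) (c rho : nat -> R).
Hypotheses (c_ge0 : forall k, 0 <= c k) (rho_ge0 : forall k, 0 <= rho k).

Let term_ge0 k y : (0 <= (c k * \1_(cube z (rho k)) y)%:E)%E.
Proof. by rewrite lee_fin mulr_ge0// indicE. Qed.

Let measurable_term k :
  measurable_fun setT (EFin \o (fun y => c k * \1_(cube z (rho k)) y)).
Proof.
apply/measurable_EFinP; apply: measurable_funM => //.
by apply: measurable_indic; exact: measurable_cube.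
Qed.

Lemma cover_ge0 y : (0 <= cover z c rho y)%E.
Proof. by rewrite /cover; apply: nneseries_ge0 => k _ _; exact: term_ge0. Qed.

Lemma measurable_cover : measurable_fun setT (cover z c rho).
Proof.
apply: ge0_emeasurable_sum => [k y _ _|k _]; first exact: term_ge0.
exact: measurable_term.
Qed.

Lemma cover_ge k y : enorm (y - z) <= rho k -> ((c k)%:E <= cover z c rho y)%E.
Proof.
move=> h; apply: le_trans (nneseries_lim_ge k.+1 _) => //.
rewrite big_nat_recr//= [X in (_ + X)%E](_ : _ = (c k)%:E); last first.
  by rewrite indicE mem_set ?mulr1//; exact: cube_enorm.
by rewrite leeDr// sume_ge0// => i _; exact: term_ge0.
Qed.

(** The series is integrated term by term; the [k]-th term contributes [c k] times the volume of its
    cube, so the last condition produces a geometric series. *)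
Lemma integral_cover K q : 0 <= q -> q < 1 ->
  (forall k, c k * (2 * rho k) ^+ n = K * q ^+ k) ->
  (\int[mu]_y cover z c rho y = (K / (1 - q))%:E)%E.
Proof.
move=> q0 q1 cK; rewrite /cover integral_nneseries//.
transitivity (\sum_(0 <= k <oo) (K * q ^+ k)%:E)%E.
  apply: eq_eseriesr => k _; rewrite -cK EFinM -(lebesgue_rV_cube z _)//.
  have mA := measurable_cube z (rho k).
  have mI : measurable_fun setT (EFin \o (\1_(cube z (rho k)) : _ -> R)).
    by apply/measurable_EFinP; exact: measurable_indic.
  under eq_integral do rewrite EFinM.
  rewrite ge0_integralZl// ?lee_fin//.
  by rewrite integral_indic// setIT.
apply/cvg_lim => //.
rewrite (_ : (fun _ => _) = EFin \o series (geometric K q)); last first.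
  by apply/funext => m; rewrite /= sumEFin.
by apply: cvg_EFin; first exact: nearW; apply: cvg_geometric_series; rewrite ger0_norm.
Qed.
End props.
End cover.

(** The least exponent whose power exceeds [t] is positive since [1 <= t]; its predecessor is the
    required [k]. *)
Lemma exists_pow2_scale (R : realType) (t : R) : 1 <= t ->
  exists k, 2 ^+ k <= t < 2 ^+ k.+1.
Proof.
move=> t1; have ex : exists k, t < 2 ^+ k.
  exists (Num.truncn t).+1; apply: lt_trans (truncnS_gt t) _.
  by rewrite -natrX ltr_nat ltn_expl.
case: (ex_minnP ex) => -[|k] tk kmin; first by move: tk; rewrite expr0 ltNge t1.
by exists k; rewrite tk andbT leNgt; apply/negP => /kmin; rewrite ltnn.
Qed.

(** * Mean value theorems along coordinate axes and second differences *)

Section mean_value.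
Context {R : realType} {n : nat}.
Implicit Types (f g : 'rV[R]_n -> R) (x y a b z : 'rV[R]_n).

Lemma partial_mvt f (j : 'I_n) z (d : R) :
  (forall x, derivable f x (delta_mx ord0 j)) ->
  exists t, [/\ 0 <= t, t <= 1 & f (z + d *: delta_mx ord0 j) - f z =
    d * partial j f (z + (t * d) *: delta_mx ord0 j)].
Proof.
move=> df; set e := delta_mx ord0 j.
pose h t := f (z + t *: e).
have hd t : is_derive t (1 : R) h (partial j f (z + t *: e)).
  (* The difference quotients of [h] at [t] are those of [f] in direction [e], so differentiability
     and derivative transfer together. *)
  have E : (fun s : R => s^-1 *: ((h \o shift t) (s *: (1 : R)) - h t)) =
      (fun s => s^-1 *: ((f \o shift (z + t *: e)) (s *: e) - f (z + t *: e))).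
    apply/funext => s; congr (_ *: (_ - _)); rewrite /h /=; congr f.
    by rewrite scalerDl addrCA -[s *: 1]/(s * 1) mulr1.
  split; first by rewrite /derivable E; exact: df.
  by rewrite /derive E.
have hc u v : {within `[u, v]%classic, continuous h}.
  by apply: derivable_within_continuous => t _; have [] := hd t.
have h0 : f z = h 0 by rewrite /h scale0r addr0.
have [d0|d0] := leP 0 d.
  have [c + E] := MVT_segment d0 (fun t _ => hd t) (hc 0 d).
  rewrite in_itv/= => /andP[c0 cd].
  move: d0; rewrite le_eqVlt => /predU1P[d0|d0].
    exists 0; rewrite lexx ler01; split => //.
    by rewrite -d0 scale0r addr0 subrr mul0r.
  exists (c / d); split; first by rewrite divr_ge0// ltW.
    by rewrite ler_pdivrMr// mul1r.
  by rewrite h0 -/(h d) E subr0 mulrC mulfVK// gt_eqF.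
(* For negative [d] the segment is traversed from [d] to [0]; [c / d] is again in the unit
   interval. *)
have [c + E] := MVT_segment (ltW d0) (fun t _ => hd t) (hc d 0).
rewrite in_itv/= => /andP[cd c0].
exists (c / d); split; first by rewrite mulr_le0// invr_le0 ltW.
  by rewrite ler_ndivrMr// mul1r.
rewrite h0 -/(h d) -opprB E sub0r mulrN opprK mulrC mulfVK// lt_eqF//.
Qed.

(* Walking from [a] to [b] one coordinate at a time, in increasing order. *)
Lemma partials_mvt f a b :
  (forall j x, derivable f x (delta_mx ord0 j)) ->
  exists (t : 'I_n -> R) (z : 'I_n -> 'rV[R]_n),
  [/\ forall j : 'I_n, 0 <= t j /\ t j <= 1,
      forall j i : 'I_n, z j ord0 i = if (i < j)%N then b ord0 i else
        if i == j then a ord0 i + t j * (b ord0 i - a ord0 i) else a ord0 i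
    & f b - f a = \sum_j (b ord0 j - a ord0 j) * partial j f (z j)].
Proof.
move=> df.
pose p (k : nat) : 'rV[R]_n := \row_i (if (i < k)%N then b ord0 i else a ord0 i).
have pS (j : 'I_n) : p j.+1 = p j + (b ord0 j - a ord0 j) *: delta_mx ord0 j.
  apply/rowP => i; rewrite !mxE eqxx /= ltnS leq_eqVlt.
  case: (eqVneq i j) => [->|ij]; first by rewrite eqxx/= ltnn mulr1 addrC subrK.
  by rewrite (negbTE (_ : nat_of_ord i != j))//= mulr0 addr0.
have /choice[t ht] : forall j : 'I_n, exists t,
    [/\ 0 <= t, t <= 1 & f (p j.+1) - f (p j) = (b ord0 j - a ord0 j) *
     partial j f (p j + (t * (b ord0 j - a ord0 j)) *: delta_mx ord0 j)].
  by move=> j; rewrite pS; exact: partial_mvt.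
exists t, (fun j : 'I_n => p j + (t j * (b ord0 j - a ord0 j)) *: delta_mx ord0 j).
split.
- by move=> j; have [] := ht j.
- move=> j i; rewrite !mxE eqxx /=; case: (eqVneq i j) => [->|ij].
    by rewrite ltnn mulr1.
  by rewrite mulr0 addr0.
- have -> : b = p n by apply/rowP => i; rewrite mxE ltn_ord.
  have -> : a = p 0%N by apply/rowP => i; rewrite mxE.
  rewrite -(telescope_sumr (fun k => f (p k)) (leq0n n)) big_mkord.
  apply: eq_bigr => j _; have [_ _ ->] := ht j.
  by rewrite !mxE ltn_ord.
Qed.

(* Only the derivatives [partial i (partial j f)] with [i <= j] occur, so that
   no symmetry of second derivatives is needed. *)
Lemma second_difference_le f x y M :
  (forall j z, derivable f z (delta_mx ord0 j)) ->
  (forall i j z, derivable (partial j f) z (delta_mx ord0 i)) ->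
  (forall (i j : 'I_n) z, (i <= j)%N ->
    (forall k, `|z ord0 k - x ord0 k| <= `|y ord0 k|) ->
    `|partial i (partial j f) z| <= M) ->
  `|2 * f x - f (x + y) - f (x - y)| <=
     \sum_j \sum_i (`|y ord0 j| * (2 * `|y ord0 i| * M)).
Proof.
move=> df ddf hM.
have [t [z [ht hz Ez]]] := @partials_mvt f x (x + y) df.
have [t' [z' [ht' hz' Ez']]] := @partials_mvt f x (x - y) df.
have zx j k : `|z j ord0 k - x ord0 k| <= `|y ord0 k|.
  rewrite hz !mxE; have [t0 t1] := ht j.
  case: ifP => _; first by rewrite (_ : _ - _ = y ord0 k)//; ring.
  case: ifP => _; last by rewrite subrr normr0.
  rewrite (_ : _ - _ = t j * y ord0 k); last by ring.
  by rewrite normrM ger0_norm// ler_piMl.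
have zx' j k : `|z' j ord0 k - x ord0 k| <= `|y ord0 k|.
  rewrite hz' !mxE; have [t0 t1] := ht' j.
  case: ifP => _; first by rewrite (_ : _ - _ = - y ord0 k) ?normrN//; ring.
  case: ifP => _; last by rewrite subrr normr0.
  rewrite (_ : _ - _ = t' j * - y ord0 k); last by ring.
  by rewrite normrM normrN ger0_norm// ler_piMl.
(* The two walks from [x] have opposite increments in each coordinate, so their first-order terms
   pair into differences of one partial derivative. A further walk from [z' j] to [z j] then brings
   in second derivatives. *)
have -> : 2 * f x - f (x + y) - f (x - y) =
    - \sum_j y ord0 j * (partial j f (z j) - partial j f (z' j)).
  transitivity (- ((f (x + y) - f x) + (f (x - y) - f x))); first by ring.
  rewrite Ez Ez' -big_split/=; congr (- _); apply: eq_bigr => j _.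
  by rewrite !mxE; ring.
rewrite normrN; apply: le_trans (ler_norm_sum _ _ _) _.
apply: ler_sum => j _; rewrite normrM -mulr_sumr ler_wpM2l//.
have [w [v [hw hv ->]]] := @partials_mvt (partial j f) (z' j) (z j) (ddf^~ j).
apply: le_trans (ler_norm_sum _ _ _) _; apply: ler_sum => i _; rewrite normrM.
have zz : `|z j ord0 i - z' j ord0 i| <= 2 * `|y ord0 i|.
  have -> : z j ord0 i - z' j ord0 i =
    (z j ord0 i - x ord0 i) - (z' j ord0 i - x ord0 i) by ring.
  apply: le_trans (ler_normB _ _) _.
  by rewrite mulrDl mul1r lerD.
have M0 : 0 <= M.
  by apply: le_trans (hM i i x (leqnn i) _) => // k; rewrite subrr normr0.
(* When [j < i], neither walk has moved coordinate [i] yet: both points agree there with [x], and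
   the term vanishes. *)
have [ij|ji] := leqP i j; last first.
  have -> : z j ord0 i - z' j ord0 i = 0.
    by rewrite hz hz' ltnNge ltnW//= -val_eqE/= gtn_eqF// subrr.
  by rewrite normr0 mul0r !mulr_ge0.
apply: ler_pM => //; apply: hM => // k; rewrite hv.
case: ifP => _; first exact: zx.
case: ifP => _; last exact: zx'.
have [w0 w1] := hw i.
(* A convex combination of two deviations from [x], each at most [|y_k|]. *)
have -> : z' j ord0 k + w i * (z j ord0 k - z' j ord0 k) - x ord0 k =
  (1 - w i) * (z' j ord0 k - x ord0 k) + w i * (z j ord0 k - x ord0 k) by ring.
apply: le_trans (ler_normD _ _) _.
have -> : `|y ord0 k| = (1 - w i) * `|y ord0 k| + w i * `|y ord0 k| by ring.
rewrite !normrM (ger0_norm w0) ger0_norm ?subr_ge0//.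
by apply: lerD; apply: ler_wpM2l => //; rewrite subr_ge0.
Qed.

Lemma mderiv0 f : mderiv (fun=> 0%N) f = f.
Proof. by rewrite /mderiv; elim: (enum _). Qed.

(** [mderiv] folds over the increasing enumeration of the indices, so the smaller index is
    differentiated last and stands outermost; hence the condition [i <= j]. *)
Lemma mderiv_partial2 f (i j : 'I_n) : (i <= j)%N ->
  mderiv (fun k => (k == i) + (k == j))%N f = partial i (partial j f).
Proof.
move=> ij; rewrite /mderiv.
set F := foldr _ f.
(* The fold is computed on lists containing neither index, then [j] but not [i], then both; meeting
   an index at the head passes to an earlier case. *)
have A s : i \notin s -> j \notin s -> F s = f.
  elim: s => //= k s IH; rewrite !inE !negb_or => /andP[ik /IH{}IH] /andP[jk /IH].
  by rewrite eq_sym (negbTE ik) eq_sym (negbTE jk).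
have B s : uniq s -> i \notin s -> j \in s -> F s = partial j f.
  elim: s => //= k s IH /andP[ks us]; rewrite !inE !negb_or => /andP[ik iNs].
  rewrite (eq_sym k i) (negbTE ik) add0n; case: (eqVneq j k) => [jk _|jk /= js].
    by subst k; rewrite /= A.
  by rewrite /= IH.
have C s : sorted (fun a b : 'I_n => (a < b)%N) s -> i \in s -> j \in s ->
    F s = partial i (partial j f).
  elim: s => //= k s IH ps.
  have tr : transitive (fun a b : 'I_n => (a < b)%N).
    by move=> a b c; exact: ltn_trans.
  have us : uniq (k :: s).
    apply: (sorted_uniq (leT := fun a b : 'I_n => (a < b)%N)) => //.
    by move=> a; rewrite ltnn.
  move: us => /= /andP[ks us].
  have ss : sorted (fun a b : 'I_n => (a < b)%N) s by exact: path_sorted ps.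
  have lt_s : {in s, forall l : 'I_n, (k < l)%N}.
    by apply/allP; exact: (order_path_min tr ps).
  rewrite !inE; case: (eqVneq i k) => [ik _|ik /= ins]; last first.
    case: (eqVneq j k) => [jk _|jk /= js].
      by have := lt_s _ ins; rewrite -jk ltnNge ij.
    by rewrite /= IH.
  subst k; case: (eqVneq j i) => [jj _|ji /= js].
    by rewrite jj /= A// jj.
  by rewrite /= B.
apply: C; rewrite ?mem_enum//.
by rewrite -[sorted _ _](@sorted_map _ _ val ltn) val_enum_ord iota_ltn_sorted.
Qed.

End mean_value.

(** * Bounding a real integral by that of a majorant *)

Section integral_bound.
Context {d : measure_display} {T : measurableType d} {R : realType}.
Variable mu : {measure set T -> \bar R}.

(* The integral of a nonnegative function is a supremum over the simple
   functions below it, so monotonicity needs no measurability. *)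
Lemma ge0_le_integral_nomeas (f g : T -> \bar R) :
  (forall x, 0 <= f x)%E -> (forall x, f x <= g x)%E ->
  (\int[mu]_x f x <= \int[mu]_x g x)%E.
Proof.
move=> f0 fg; have g0 x : (0 <= g x)%E by exact: le_trans (fg x).
rewrite !ge0_integralE//; apply: ereal_sup_le => _ [h hf <-]; exists h => //.
move=> x; apply: le_trans (hf x) _.
by rewrite !patch_setT.
Qed.

(** The integrals of the positive and negative parts both lie between [0] and [M], hence so does the
    absolute value of their difference. *)
Lemma normr_Rintegral_le (g : T -> R) (H : T -> \bar R) (M : R) :
  (forall x, (`|g x|%:E <= H x)%E) -> (\int[mu]_x H x <= M%:E)%E ->
  `|\int[mu]_x g x| <= M.
Proof.
move=> gH HM; rewrite /Rintegral integralE.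
have P0 : (0 <= \int[mu]_x (fun x => (g x)%:E)^\+ x)%E by exact: integral_ge0.
have N0 : (0 <= \int[mu]_x (fun x => (g x)%:E)^\- x)%E by exact: integral_ge0.
have PM : (\int[mu]_x (fun x => (g x)%:E)^\+ x <= M%:E)%E.
  apply: le_trans HM; apply: ge0_le_integral_nomeas => // x.
  apply: le_trans (gH x); rewrite funeposE -EFin_max lee_fin.
  by rewrite ge_max ler_norm normr_ge0.
have NM : (\int[mu]_x (fun x => (g x)%:E)^\- x <= M%:E)%E.
  apply: le_trans HM; apply: ge0_le_integral_nomeas => // x.
  apply: le_trans (gH x); rewrite funenegE -EFinN -EFin_max lee_fin.
  by rewrite ge_max ler_normr lexx orbT normr_ge0.
move: P0 N0 PM NM.
case: (\int[mu]_x (fun x => (g x)%:E)^\+ x)%E => // p;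
case: (\int[mu]_x (fun x => (g x)%:E)^\- x)%E => // m.
rewrite !lee_fin /= => p0 m0 pM mM.
by rewrite ler_norml; apply/andP; split; lra.
Qed.

End integral_bound.

(** * Real powers and the polynomial weight *)

Section scales.
Context {R : realType}.
Implicit Types (a t r : R) (k n : nat).

Lemma powR_exp2 a k : (2 ^+ k) `^ a = (2 `^ a) ^+ k.
Proof.
by rewrite -(powR_mulrn k (ler0n R 2)) -(powR_mulrn k (powR_ge0 2 a)) -!powRrM mulrC.
Qed.

Lemma powR_exprD_nat (n : nat) a t : 0 < t -> t `^ (n%:R + a) = t ^+ n * t `^ a.
Proof. move=> t0; rewrite powRD; last by rewrite (gt_eqF t0) implybT.
by rewrite powR_mulrn// ltW. Qed.

Lemma powR_gt1 t a : 1 < t -> 0 < a -> 1 < t `^ a.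
Proof.
move=> t1 a0; apply: (@le_lt_trans _ _ (1 `^ a)); first by rewrite powR1.
by apply: gt0_ltr_powR; rewrite ?nnegrE// ltW// (lt_trans _ t1).
Qed.

Lemma expr_le_weight n t : 0 <= t -> t ^+ n <= (1 + t ^+ 2) `^ (n%:R / 2).
Proof.
move=> t0; have -> : t ^+ n = (t ^+ 2) `^ (n%:R / 2).
  by rewrite -(powR_mulrn n t0) -(powR_mulrn 2 t0) -powRrM mulrC divfK.
apply: ge0_ler_powR; rewrite ?nnegrE ?divr_ge0 ?sqr_ge0 ?addr_ge0 ?sqr_ge0//.
by rewrite lerDr.
Qed.

Lemma weight_ge1 n t : 1 <= (1 + t ^+ 2) `^ (n%:R / 2).
Proof.
apply: (@le_trans _ _ (1 `^ (n%:R / 2))); first by rewrite powR1.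
apply: ge0_ler_powR.
- by rewrite divr_ge0.
- by rewrite nnegrE.
- by rewrite nnegrE addr_ge0// sqr_ge0.
- by rewrite lerDl sqr_ge0.
Qed.

End scales.

(** * The Euclidean norm *)

Section enorm.
Context {R : realType} {n : nat}.
Implicit Types x y z : 'rV[R]_n.

Lemma enormN y : enorm (- y) = enorm y.
Proof. by rewrite /enorm; under eq_bigr do rewrite mxE sqrrN. Qed.

Lemma enorm_sqr y : enorm y ^+ 2 = \sum_(i < n) y ord0 i ^+ 2.
Proof. by rewrite sqr_sqrtr// sumr_ge0// => i _; exact: sqr_ge0. Qed.

(* From [x_i^2 <= 2 z_i^2 + 2 (x_i - z_i)^2]: the triangle inequality for the
   Euclidean norm is not needed. *)
Lemma half_enorm_le x y z : enorm y <= enorm x / 2 ->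
  (forall i, `|z ord0 i - x ord0 i| <= `|y ord0 i|) -> enorm x / 2 <= enorm z.
Proof.
move=> yx zxy.
have key : enorm x ^+ 2 <= 2 * enorm z ^+ 2 + 2 * enorm y ^+ 2.
  rewrite !enorm_sqr !mulr_sumr -big_split/=; apply: ler_sum => i _.
  have h : (z ord0 i - x ord0 i) ^+ 2 <= y ord0 i ^+ 2.
    rewrite -(real_normK (num_real (z _ _ - _))).
    by rewrite -(real_normK (num_real (y _ _))) lerXn2r ?nnegrE.
  (* [2 z^2 + 2 (x - z)^2 - x^2 = (2 z - x)^2]. *)
  have := sqr_ge0 (2 * z ord0 i - x ord0 i); nra.
have hy : enorm y ^+ 2 <= (enorm x / 2) ^+ 2.
  by rewrite lerXn2r ?nnegrE ?divr_ge0 ?enorm_ge0.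
rewrite -(@ler_pXn2r _ 2) ?nnegrE ?divr_ge0 ?enorm_ge0//; nra.
Qed.

End enorm.

(** * The estimate for real-valued functions *)

Section real_valued.
Context {R : realType} {n : nat}.
Variable s : R.
Hypotheses (s_gt0 : 0 < s) (s_lt1 : s < 1).
Implicit Types (x y z w : 'rV[R]_n).
Local Notation mu := (@lebesgue_rV R n).

Let a : R := n%:R + 2 * s.
Let B : R := 2 `^ a.
(** The geometric ratios are [theta / 4] near the singularity and [theta^-1] far from it;
    [0 < s < 1] places [theta] strictly between 1 and 4, so both series converge. *)
Let theta : R := 2 `^ (2 * s).

Let thetaE : B = 2 ^+ n * theta.
Proof. by rewrite /B powR_exprD_nat. Qed.

Let theta_gt1 : 1 < theta.
Proof. by apply: powR_gt1; [rewrite ltr1n|rewrite mulr_gt0]. Qed.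

Let theta_lt4 : theta < 4.
Proof.
have E : theta * 2 `^ (2 - 2 * s) = 4.
  by rewrite -powRD ?pnatr_eq0 ?implybT// addrC subrK powR_mulrn//; ring.
rewrite -E ltr_pMr ?powR_gt0//; apply: powR_gt1; first by rewrite ltr1n.
by rewrite subr_gt0 gtr_pMr.
Qed.

Let B_gt0 : 0 < B. Proof. exact: powR_gt0. Qed.

(** The integrals, up to the common factor [N / P], of the majorants for the second difference near
    0, for [f x] far from 0, and for the two translates of [f]. *)
Definition fracLap_bound : R :=
  2 * n%:R ^+ 2 * 2 ^+ n * B / (1 - theta / 4) +
  2 * 4 ^+ n / (1 - theta^-1) +
  2 * (2 ^+ (n + 2) * 2 ^+ n / (1 - 4^-1)).

Lemma fracLap_bound_ge0 : 0 <= fracLap_bound.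
Proof.
have := theta_gt1; have := theta_lt4; have := B_gt0 => B0 t4 t1.
have h1 : 0 <= 1 - theta / 4 by lra.
have h2 : 0 <= 1 - theta^-1 by rewrite subr_ge0 invf_le1 ?ltW//; lra.
have h3 : 0 <= 1 - 4^-1 :> R by lra.
have hB : 0 <= B by exact: ltW.
by rewrite addr_ge0 ?addr_ge0 ?divr_ge0// ?mulr_ge0// ?exprn_ge0// invr_ge0.
Qed.

Section bound.
Variables (f : 'rV[R]_n -> R) (N : R).
Hypotheses
  (df : forall j z, derivable f z (delta_mx ord0 j))
  (ddf : forall i j z, derivable (partial j f) z (delta_mx ord0 i))
  (f_le : forall z, (1 + enorm z ^+ 2) `^ ((n + 2)%:R / 2) * `|f z| <= N)
  (ddf_le : forall (i j : 'I_n) z, (i <= j)%N ->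
    (1 + enorm z ^+ 2) `^ ((n + 2)%:R / 2) * `|partial i (partial j f) z| <= N).

Let N_ge0 : 0 <= N.
Proof. by apply: le_trans (f_le 0); rewrite mulr_ge0 ?powR_ge0. Qed.

Let decay z (v t : R) :
  (1 + enorm z ^+ 2) `^ ((n + 2)%:R / 2) * `|v| <= N ->
  0 < t -> t <= enorm z -> `|v| <= N / t ^+ (n + 2).
Proof.
move=> vN t0 tz; rewrite ler_pdivlMr ?exprn_gt0// mulrC.
apply: le_trans vN; apply: ler_wpM2r => //.
apply: le_trans (expr_le_weight _ _ (enorm_ge0 z)).
by rewrite lerXn2r// nnegrE ?enorm_ge0// ltW.
Qed.

(** Outside the unit ball the decay is taken at the inner radius of the dyadic shell, and the factor
    [2 ^+ (n + 2)] pays for the passage to the outer one; inside, [k = 0] and the weight is at least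
    1. *)
Lemma decay_dyadic w : exists k, enorm w <= 2 ^+ k /\
  `|f w| <= N * 2 ^+ (n + 2) / (2 ^+ (n + 2)) ^+ k.
Proof.
have [w1|w1] := leP (enorm w) 1.
  exists 0%N; rewrite !expr0 divr1; split => //.
  apply: (@le_trans _ _ N).
    apply: le_trans (f_le w); rewrite ler_peMl//; exact: weight_ge1.
  by rewrite ler_peMr// exprn_ege1// ler1n.
have [k /andP[k1 k2]] := exists_pow2_scale _ _ (ltW w1).
exists k.+1; split; first exact: ltW.
have -> : N * 2 ^+ (n + 2) / (2 ^+ (n + 2)) ^+ k.+1 = N / (2 ^+ k) ^+ (n + 2).
  by rewrite exprS invfM mulrA mulfK ?expf_neq0// -!exprM mulnC.
by apply: (decay _ _ _ (f_le w) _ k1); exact: exprn_gt0.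
Qed.

Variable x : 'rV[R]_n.
Hypothesis x_gt1 : 1 < enorm x.

Let r := enorm x / 2.
Let P := r `^ a.

Let r_gt0 : 0 < r. Proof. by rewrite divr_gt0// (lt_trans _ x_gt1). Qed.
Let P_gt0 : 0 < P. Proof. exact: powR_gt0. Qed.

(** Bounds at scale [k] for the near part, for [f x], and for the translates, to be used on cubes of
    half-sides [rn], [rf], [rt]. In [cn] and [cf] the kernel is taken at the inner radius of the
    shell: the denominators are the [a]-th powers of [r / 2 ^+ k.+1] and [2 ^+ k * r]. In [ct] the
    kernel is replaced by [P^-1]. *)
Let cn k := 2 * n%:R ^+ 2 * (N / r ^+ (n + 2)) * (r / 2 ^+ k) ^+ 2 /
  (P / B ^+ k.+1).
Let cf k := 2 * (N / r ^+ n) / (B ^+ k * P).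
Let ct k := N / P * 2 ^+ (n + 2) / (2 ^+ (n + 2)) ^+ k.

Let rn k := r / 2 ^+ k.
Let rf k := 2 ^+ k.+1 * r.
Let rt k : R := 2 ^+ k.

Let a_gt0 : 0 < a.
Proof. by rewrite /a ltr_wpDl// mulr_gt0. Qed.

Let cn_ge0 k : 0 <= cn k.
Proof.
by rewrite /cn !(divr_ge0, mulr_ge0, exprn_ge0)//;
  first [exact: enorm_ge0 | exact: powR_ge0].
Qed.

Let cf_ge0 k : 0 <= cf k.
Proof.
by rewrite /cf !(divr_ge0, mulr_ge0, exprn_ge0)//;
  first [exact: enorm_ge0 | exact: powR_ge0].
Qed.

Let ct_ge0 k : 0 <= ct k.
Proof.
by rewrite /ct !(divr_ge0, mulr_ge0, exprn_ge0)//;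
  first [exact: enorm_ge0 | exact: powR_ge0].
Qed.

Let near y : enorm y <= r ->
  exists k, enorm y <= r / 2 ^+ k /\
    `|2 * f x - f (x + y) - f (x - y)| / enorm y `^ a <= cn k.
Proof.
(* At the singularity the quotient is [0], because the inverse of [0] is [0]. *)
move=> yr; have [y0|] := eqVneq (enorm y) 0.
  exists 0%N; rewrite y0 powR0 ?gt_eqF// invr0 mulr0; split.
    by rewrite divr_ge0// ltW.
  exact: cn_ge0.
move=> y_neq0; have y0 : 0 < enorm y by rewrite lt_def y_neq0 enorm_ge0.
have [|k /andP[k1 k2]] := exists_pow2_scale R (r / enorm y).
  by rewrite ler_pdivlMr// mul1r.
have yk : enorm y <= r / 2 ^+ k.
  by rewrite ler_pdivlMr ?exprn_gt0// mulrC -ler_pdivlMr.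
have ky : r / 2 ^+ k.+1 <= enorm y.
  by rewrite ler_pdivrMr ?exprn_gt0// mulrC -ler_pdivrMr// ltW.
exists k; split => //.
rewrite /cn; have -> : P / B ^+ k.+1 = (r / 2 ^+ k.+1) `^ a.
  rewrite powRM ?invr_ge0 ?exprn_ge0 ?(ltW r_gt0)//.
  by rewrite -(powR_inv1 (exprn_ge0 _ (ler0n R 2))) powRAC powR_exp2 powR_inv1 ?exprn_ge0 ?powR_ge0.
apply: ler_pM; rewrite ?invr_ge0 ?powR_ge0//; last first.
- have rk0 : 0 < r / 2 ^+ k.+1.
    by apply: divr_gt0; [exact: r_gt0|exact: exprn_gt0].
  rewrite lef_pV2 ?posrE ?powR_gt0//.
  by apply: ge0_ler_powR => //; rewrite ?nnegrE ltW.
set M := N / r ^+ (n + 2).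
have M0 : 0 <= M by rewrite divr_ge0// exprn_ge0// ltW.
have hM (i j : 'I_n) z : (i <= j)%N ->
    (forall k, `|z ord0 k - x ord0 k| <= `|y ord0 k|) ->
    `|partial i (partial j f) z| <= M.
  move=> ij zy; apply: (decay _ _ _ (ddf_le _ _ _ ij) r_gt0).
  exact: half_enorm_le yr zy.
clearbody M.
apply: le_trans (second_difference_le f x y M df ddf hM) _.
apply: (@le_trans _ _ (\sum_(j < n) \sum_(i < n) (enorm y * (2 * enorm y * M)))).
  apply: ler_sum => j _; apply: ler_sum => i _.
  apply: ler_pM; [by []|by rewrite !mulr_ge0|exact: ler_coord_enorm|].
  by apply: ler_wpM2r => //; apply: ler_wpM2l => //; exact: ler_coord_enorm.
rewrite !sumr_const card_ord -[leLHS]mulrnA -[leLHS]mulr_natr natrM.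
rewrite (_ : _ * _ = 2 * n%:R ^+ 2 * M * enorm y ^+ 2); last by ring.
apply: ler_wpM2l; first by rewrite !mulr_ge0.
by rewrite lerXn2r ?nnegrE ?enorm_ge0// (le_trans (enorm_ge0 y) yk).
Qed.

(** As [enorm x > 1], the exponent may drop from [n + 2] to [n]; the missing [r] to the power
    [- 2 s] comes from integrating the kernel outside radius [r]. *)
Let fx_le : `|f x| <= N / r ^+ n.
Proof.
have x0 : 0 < enorm x by rewrite (lt_trans _ x_gt1).
apply: le_trans (decay _ _ _ (f_le x) x0 (lexx _)) _.
apply: ler_wpM2l => //; rewrite lef_pV2 ?posrE ?exprn_gt0//.
apply: (@le_trans _ _ (enorm x ^+ n)).
  by rewrite lerXn2r ?nnegrE ?ltW// /r; have := x_gt1; lra.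
by rewrite ler_weXn2l ?ltW// leq_addr.
Qed.

Let far y : r < enorm y ->
  exists k, enorm y <= 2 ^+ k.+1 * r /\ 2 * `|f x| / enorm y `^ a <= cf k.
Proof.
move=> ry; have y0 : 0 < enorm y by exact: lt_trans ry.
have [|k /andP[k1 k2]] := exists_pow2_scale R (enorm y / r).
  by rewrite ler_pdivlMr// mul1r ltW.
have yk : enorm y <= 2 ^+ k.+1 * r by rewrite -ler_pdivrMr// ltW.
have ky : 2 ^+ k * r <= enorm y by rewrite -ler_pdivlMr.
exists k; split => //.
rewrite /cf; have -> : B ^+ k * P = (2 ^+ k * r) `^ a.
  by rewrite powRM ?exprn_ge0 ?(ltW r_gt0)// powR_exp2.
apply: ler_pM; rewrite ?mulr_ge0 ?invr_ge0 ?powR_ge0//.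
- by rewrite ler_wpM2l.
- have rk0 : 0 < 2 ^+ k * r.
    by apply: mulr_gt0; [exact: exprn_gt0|exact: r_gt0].
  rewrite lef_pV2 ?posrE ?powR_gt0//.
  by apply: ge0_ler_powR => //; rewrite ?nnegrE ltW.
Qed.

(** The kernel is bounded by its value at radius [r], and the decay in [k] comes from [f] at [w];
    the cubes will therefore be centred where [w = 0]. *)
Let tail y w : r < enorm y -> exists k, enorm w <= 2 ^+ k /\
  `|f w| / enorm y `^ a <= ct k.
Proof.
move=> ry; have [k [wk fk]] := decay_dyadic w; exists k; split => //.
rewrite (_ : ct k = N * 2 ^+ (n + 2) / (2 ^+ (n + 2)) ^+ k / P); last first.
  by rewrite /ct; ring.
apply: ler_pM; rewrite ?invr_ge0 ?powR_ge0//.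
have y0 : 0 < enorm y by exact: lt_trans ry.
rewrite lef_pV2 ?posrE ?powR_gt0//.
by apply: ge0_ler_powR => //; rewrite ?nnegrE ltW.
Qed.

Let H y : \bar R :=
  (cover 0 cn rn y + cover 0 cf rf y +
   (cover (- x) ct rt y + cover x ct rt y))%E.

Let H_ge y :
  (`|(2 * f x - f (x + y) - f (x - y)) / enorm y `^ a|%:E <= H y)%E.
Proof.
have C z c rho : (forall k, 0 <= c k) -> (0 <= @cover R n z c rho y)%E.
  by move=> c0; exact: cover_ge0.
rewrite normrM (ger0_norm (_ : 0 <= (_ `^ _)^-1)) ?invr_ge0 ?powR_ge0//.
have [yr|ry] := leP (enorm y) r.
  have [k [yk Dk]] := near y yr.
  apply: (@le_trans _ _ (cover 0 cn rn y)).
    apply: le_trans (cover_ge _ _ _ cn_ge0 k _ _); rewrite ?subr0// lee_fin//.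
  by rewrite /H -addeA leeDl// !adde_ge0 ?C.
have [k1 [y1 D1]] := far y ry.
have [k2 [y2 D2]] := tail y (x + y) ry.
have [k3 [y3 D3]] := tail y (x - y) ry.
apply: (@le_trans _ _ ((cf k1)%:E + ((ct k2)%:E + (ct k3)%:E))%E).
  rewrite -!EFinD lee_fin.
  apply: le_trans (lerD D1 (lerD D2 D3)); rewrite -!mulrDl.
  apply: ler_wpM2r; first by rewrite invr_ge0 powR_ge0.
  apply: le_trans (ler_normB _ _) _; rewrite addrA lerD2r.
  by apply: le_trans (ler_normB _ _) _; rewrite normrM normr_nat.
apply: leeD; last apply: leeD.
- apply: (@le_trans _ _ (cover 0 cf rf y)).
    by apply: cover_ge => //; rewrite subr0.
  by rewrite leeDr ?C.
(* [x + y] is [y - (- x)], and [x - y] has the norm of [y - x]: hence the centres [- x] and [x]. *)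
- by apply: cover_ge => //; rewrite opprK addrC.
- by apply: cover_ge => //; rewrite -enormN opprB.
Qed.

Let integral_H : (\int[mu]_y H y = (fracLap_bound * (N / P))%:E)%E.
Proof.
have C z c rho y : (forall k, 0 <= c k) -> (0 <= @cover R n z c rho y)%E.
  by move=> c0; exact: cover_ge0.
have mC z c rho : (forall k, 0 <= c k) ->
    measurable_fun setT (@cover R n z c rho).
  by move=> c0; exact: measurable_cover.
have [t1 t4] := (theta_gt1, theta_lt4).
have t0 : 0 < theta by exact: lt_trans t1.
rewrite /H ge0_integralD//; last 4 first.
- by move=> y _; rewrite adde_ge0 ?C.
- by apply: emeasurable_funD; exact: mC.
- by move=> y _; rewrite adde_ge0 ?C.
- by apply: emeasurable_funD; exact: mC.
rewrite ge0_integralD//; last 4 first.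
- by move=> y _; exact: C.
- exact: mC.
- by move=> y _; exact: C.
- exact: mC.
rewrite ge0_integralD//; last 4 first.
- by move=> y _; exact: C.
- exact: mC.
- by move=> y _; exact: C.
- exact: mC.
have wE k : (2 ^+ n) ^+ k = (2 ^+ k) ^+ n :> R by rewrite -!exprM mulnC.
have w4 k : 4 ^+ k = (2 ^+ k) ^+ 2 :> R.
  by rewrite -exprM mulnC exprM; congr (_ ^+ k); ring.
have BE k : B ^+ k = (2 ^+ k) ^+ n * theta ^+ k by rewrite thetaE exprMn wE.
have w_neq0 k : 2 ^+ k != 0 :> R by rewrite expf_neq0.
have wn_neq0 k : (2 ^+ k) ^+ n != 0 :> R by rewrite expf_neq0.
have th_neq0 k : theta ^+ k != 0 by rewrite expf_neq0// gt_eqF.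
have r_neq0 : r != 0 by rewrite gt_eqF.
have rn_neq0 : r ^+ n != 0 by rewrite expf_neq0.
have P_neq0 : P != 0 by rewrite gt_eqF.
have B_neq0 : B != 0 by rewrite gt_eqF.
(* The ratio is [B] from the kernel, [1 / 4] from the squared radius and [2 ^- n] from the volume,
   that is [theta / 4]. *)
rewrite (@integral_cover R n 0 cn rn cn_ge0 _
  (2 * n%:R ^+ 2 * 2 ^+ n * B * (N / P)) (theta / 4)); last 4 first.
- by move=> k; rewrite divr_ge0 ?exprn_ge0// ltW.
- by rewrite divr_ge0// ltW.
- by rewrite ltr_pdivrMr// mul1r.
- move=> k; rewrite /cn /rn [B ^+ k.+1]exprS BE [(theta / 4) ^+ k]expr_div_n w4.
  rewrite [(2 * _) ^+ n]exprMn [(r / 2 ^+ k) ^+ n]expr_div_n [r ^+ (n + 2)]exprD.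
  (* Powers with symbolic exponents are generalized to nonzero variables, leaving an identity of
     rational functions. *)
  move: (w_neq0 k) (wn_neq0 k) (th_neq0 k) r_neq0 rn_neq0 P_neq0 B_neq0.
  move: (2 ^+ k) ((2 ^+ k) ^+ n) (theta ^+ k) (r ^+ n) (2 ^+ n).
  move: r P B => r' P' B' w wn th r'n two_n *.
  by field; do ?[apply/andP; split].
rewrite (@integral_cover R n 0 cf rf cf_ge0 _
  (2 * 4 ^+ n * (N / P)) (theta^-1)); last 4 first.
- by move=> k; rewrite mulr_ge0 ?exprn_ge0// ltW.
- by rewrite invr_ge0 ltW.
- by rewrite invf_lt1.
- move=> k; rewrite /cf /rf BE exprVn [2 ^+ k.+1]exprS.
  rewrite (_ : (2 * _) ^+ n = 4 ^+ n * (2 ^+ k) ^+ n * r ^+ n); last first.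
    by rewrite -!exprMn; congr (_ ^+ n); ring.
  move: (w_neq0 k) (wn_neq0 k) (th_neq0 k) r_neq0 rn_neq0 P_neq0 B_neq0.
  move: (2 ^+ k) ((2 ^+ k) ^+ n) (theta ^+ k) (r ^+ n) (4 ^+ n).
  move: P => P' w wn th r'n two_n *.
  by field; do ?[apply/andP; split].
have E z : (\int[mu]_y cover z ct rt y =
    (N / P * (2 ^+ (n + 2) * 2 ^+ n) / (1 - 4^-1))%:E)%E.
  apply: integral_cover => //.
  - by move=> k; rewrite exprn_ge0.
  - by rewrite invf_lt1// ltr1n.
  - move=> k; rewrite /ct /rt exprVn exprMn w4 -[(2 ^+ (n + 2)) ^+ k]exprM mulnC.
    rewrite [(2 ^+ (k * _))]exprM [(2 ^+ k) ^+ (n + 2)]exprD.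
    move: (w_neq0 k) (wn_neq0 k) P_neq0.
    move: (2 ^+ k) ((2 ^+ k) ^+ n) (2 ^+ n) (2 ^+ (n + 2)).
    move: P => P' w wn two_n two_n2 *.
    by field; do ?[apply/andP; split].
rewrite !E -!EFinD; congr EFin; rewrite /fracLap_bound.
by ring.
Qed.

Lemma real_fracLap_le :
  `|\int[mu]_y ((2 * f x - f (x + y) - f (x - y)) / enorm y `^ a)| <=
    fracLap_bound * B * N * enorm x `^ (- a).
Proof.
have -> : fracLap_bound * B * N * enorm x `^ (- a) = fracLap_bound * (N / P).
  have E : P = enorm x `^ a / B.
    rewrite /P /r powRM ?enorm_ge0//.
    by rewrite -(powR_inv1 (ler0n R 2)) -powRrM mulN1r [X in _ * X]powRN.
  by rewrite E powRN invfM invrK; ring.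
by apply: (normr_Rintegral_le _ _ _ _ H_ge); rewrite integral_H.
Qed.

End bound.
End real_valued.

(** * Complex modulus against real and imaginary parts *)

Section complex_valued.
Context {R : realType}.
Implicit Types z w : R[i].

Lemma ler_Re_normc z : `|complex.Re z| <= Normc.normc z.
Proof.
case: z => p q /=; rewrite -sqrtr_sqr ler_sqrt ?addr_ge0 ?sqr_ge0//.
by rewrite lerDl sqr_ge0.
Qed.

Lemma ler_Im_normc z : `|complex.Im z| <= Normc.normc z.
Proof.
case: z => p q /=; rewrite -sqrtr_sqr ler_sqrt ?addr_ge0 ?sqr_ge0//.
by rewrite lerDr sqr_ge0.
Qed.

Lemma normc_le_ReIm z :
  Normc.normc z <= `|complex.Re z| + `|complex.Im z|.
Proof.
case: z => p q /=.
rewrite -(@ler_pXn2r _ 2) ?nnegrE ?sqrtr_ge0 ?addr_ge0//.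
rewrite sqr_sqrtr ?addr_ge0 ?sqr_ge0// sqrrD !real_normK ?num_real//.
by rewrite addrAC lerDl mulrn_wge0// mulr_ge0.
Qed.

Lemma complex_mul2 z : 2 * z = Complex (2 * complex.Re z) (2 * complex.Im z).
Proof. by case: z => p q; rewrite !mulr_natl !mulr2n. Qed.

Lemma complex_divr z (t : R) :
  z / (t%:C)%C = Complex (complex.Re z / t) (complex.Im z / t).
Proof.
by case: z => p q; rewrite -fmorphV/=; simpc.
Qed.

End complex_valued.

(** * Schwartz norms and the final estimate *)

Lemma le_schwartz_norm (R : realType) (n p : nat) (u : 'rV[R]_n -> R[i])
    (alpha : 'I_n -> nat) (x : 'rV[R]_n) : (\sum_i alpha i <= p)%N ->
  (((1 + enorm x ^+ 2) `^ (p%:R / 2) * Normc.normc (cmderiv alpha u x))%:E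
    <= schwartz_norm p u)%E.
Proof.
move=> ap; apply: le_trans; last first.
  by apply: ereal_sup_ubound; exists alpha.
by apply: ereal_sup_ubound; exists x.
Qed.

Lemma schwartz_norm_ge0 (R : realType) (n p : nat) (u : 'rV[R]_n -> R[i]) :
  (0 <= schwartz_norm p u)%E.
Proof.
have := @le_schwartz_norm R n p u (fun=> 0%N) 0.
rewrite sum_nat_const muln0 => /(_ isT); apply: le_trans.
by rewrite lee_fin mulr_ge0 ?powR_ge0// (le_trans _ (ler_Re_normc _)).
Qed.

Lemma sum_two_indicators (n : nat) (i j : 'I_n) : (\sum_k ((k == i) + (k == j)) = 2)%N.
Proof.
have E l : (\sum_(k < n) (k == l) = 1)%N.
  by rewrite (bigD1 l)//= eqxx big1// => k /negbTE ->.
by rewrite big_split/= !E.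
Qed.

Theorem proposition2p9 (R : realType) (n : nat) (s : R)
    (n_ge1 : (1 <= n)%N) (s_gt0 : 0 < s) (s_lt1 : s < 1) :
  exists C : R, 0 < C /\
    forall u : 'rV[R]_n -> R[i], schwartz u ->
    forall x : 'rV[R]_n, 1 < enorm x ->
      ((Normc.normc (fracLap s u x))%:E <=
        C%:E * (schwartz_norm (n + 2) u + schwartz_norm n u +
                'N[@lebesgue_rV R n]_1[(fun y => (Normc.normc (u y))%:E)]) *
        (enorm x `^ (- (n%:R + 2 * s)))%:E)%E.
Proof.
set a := n%:R + 2 * s.
pose K := @fracLap_bound R n s * 2 `^ a.
have K0 : 0 <= K by rewrite mulr_ge0 ?powR_ge0// fracLap_bound_ge0.
pose c := fracLap_cst n s / 2.
have cK0 : 0 <= `|c| * (2 * K) by apply: mulr_ge0 => //; exact: mulr_ge0.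
(* The factor 2 accounts for real and imaginary parts; adding 1 gives positivity directly from
   [0 <= K]. *)
exists (`|c| * (2 * K) + 1); split; first by rewrite ltr_wpDl.
move=> u [[sRe sIm] uoo] x x1.
have SN : schwartz_norm (n + 2) u = (fine (schwartz_norm (n + 2) u))%:E.
  rewrite fineK// ge0_fin_numE; first exact: uoo.
  exact: schwartz_norm_ge0.
move: (fine _) SN => N SN.
have Nge al z : (\sum_i al i <= n + 2)%N ->
    (1 + enorm z ^+ 2) `^ ((n + 2)%:R / 2) * Normc.normc (cmderiv al u z) <= N.
  by move=> /(le_schwartz_norm _ _ _ u _ z); rewrite SN lee_fin.
have N0 : 0 <= N by rewrite -lee_fin -SN schwartz_norm_ge0.
have bound (f : 'rV[R]_n -> R) : smooth f ->
    (forall al z, `|mderiv al f z| <= Normc.normc (cmderiv al u z)) ->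
    `|\int[@lebesgue_rV R n]_y
      ((2 * f x - f (x + y) - f (x - y)) / enorm y `^ a)| <=
    K * N * enorm x `^ (- a).
  move=> sf fu; apply: real_fracLap_le => //.
  - by move=> j z; have [h _] := sf [::]; exact: h.
  - by move=> i j z; have [h _] := sf [:: j]; exact: h.
  - move=> z; apply: le_trans (Nge (fun=> 0%N) z _); last first.
      by rewrite sum_nat_const muln0.
    by apply: ler_wpM2l; [exact: powR_ge0|rewrite -[f in leLHS]mderiv0].
  - move=> i j z ij.
    apply: le_trans (Nge (fun k => (k == i) + (k == j))%N z _); last first.
      by rewrite sum_two_indicators leq_addl.
    by apply: ler_wpM2l; [exact: powR_ge0|rewrite -mderiv_partial2].
(* By definition, [mderiv] of the real part of [u] is the real part of [cmderiv]. *)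
have bRe := bound _ sRe (fun al z => ler_Re_normc (cmderiv al u z)).
have bIm := bound _ sIm (fun al z => ler_Im_normc (cmderiv al u z)).
have le1 : Normc.normc (fracLap s u x) <=
    (`|c| * (2 * K) + 1) * N * enorm x `^ (- a).
  rewrite /fracLap Normc.normcM -/c.
  have -> : Normc.normc (c%:C)%C = `|c|.
    by rewrite /= expr0n addr0 sqrtr_sqr.
  apply: (@le_trans _ _ (`|c| * (2 * K * N * enorm x `^ (- a)))); last first.
    rewrite !mulrA; do 2 (apply: ler_wpM2r; rewrite ?powR_ge0//).
    by rewrite lerDl.
  apply: ler_wpM2l => //; apply: le_trans (normc_le_ReIm _) _.
  rewrite (_ : 2 * K * N * _ = K * N * enorm x `^ (- a) +
    K * N * enorm x `^ (- a)); last by ring.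
  apply: lerD.
    apply: le_trans bRe; rewrite le_eqVlt; apply/orP; left; apply/eqP.
    congr (`|_|); apply: eq_Rintegral => y _.
    rewrite complex_divr complex_mul2.
  by case: (u x) (u (x + y)) (u (x - y)) => [p q] [p' q'] [p'' q''].
  apply: le_trans bIm; rewrite le_eqVlt; apply/orP; left; apply/eqP.
  congr (`|_|); apply: eq_Rintegral => y _.
  rewrite complex_divr complex_mul2.
  by case: (u x) (u (x + y)) (u (x - y)) => [p q] [p' q'] [p'' q''].
apply: (@le_trans _ _ (((`|c| * (2 * K) + 1) * N * enorm x `^ (- a))%:E)).
  by rewrite lee_fin.
rewrite 2!EFinM; apply: lee_wpmul2r; first by rewrite lee_fin powR_ge0.
apply: lee_wpmul2l; first by rewrite lee_fin addr_ge0.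
(* The other two norms are nonnegative, so adding them only enlarges the bound. *)
by rewrite -SN -addeA leeDl// adde_ge0 ?schwartz_norm_ge0 ?Lnorm_ge0//.
Qed.
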